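(* Assume Assumption $(\ast)$: for all positive integers $a, f$ with $1\leq a\leq f$, $\gcd(a,f)=1$ and $4\mid f$, and every odd prime $g$ dividing $f$ such that $\left(\frac{g}{a}\right)=-1$, there exists a prime $p$ such that $p\equiv a \pmod f$ and $g$ is a primitive root modulo $p$. Then for every positive integer $m$, there exist infinitely many weakly prime-additive numbers $n$ with $m\mid n$ and $\kappa_n=4$.
   Context: $\left(\frac{\cdot}{\cdot}\right)$ denotes the Kronecker symbol. A positive integer $n$ is weakly prime-additive if $n$ has at least 2 distinct prime divisors and there exist distinct prime divisors $p_1,\dots,p_t$ of $n$ and positive integers $a_1,\dots,a_t$ such that $n=p_1^{a_1}+\cdots+p_t^{a_t}$ (the $p_i$ need not be all the prime divisors of $n$). The minimal value of such $t$ is called the length of $n$ and is denoted $\kappa_n$. *)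

(* Defs.v *)
From HB Require Import structures.
From mathcomp Require Import all_boot all_order all_algebra.
From mathcomp Require Import boolp classical_sets cardinality.

Set Implicit Arguments.
Unset Strict Implicit.
Unset Printing Implicit Defensive.

Import GRing.Theory Num.Theory.

(* (a / p) for p prime: the Legendre symbol when p is odd, and the usual
   convention at p = 2; only meaningful when p is prime. *)
Definition kronecker_prime (a : int) (p : nat) : int :=
  (if p == 2%N then
     if (2 %| a)%Z then 0
     else if (a %% 8)%Z \in [:: 1; 7] then 1 else -1
   else if (p%:Z %| a)%Z then 0
   else if [exists x : 'F_p, x ^+ 2 == a%:~R] then 1 else -1)%R.

(* The sign test is the factor (a / -1) carried by a negative n. *)
Definition kronecker (a n : int) : int :=
  (if n == 0 then (`|a| == 1)%:R
   else (if (n < 0) && (a < 0) then -1 else 1) *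
        \prod_(p <- primes `|n|%N) kronecker_prime a p ^+ logn p `|n|%N)%R.

(* For prime p, that g has multiplicative order exactly p - 1 modulo p. *)
Definition primitive_root_mod (g p : nat) : Prop :=
  ((p.-1).-primitive_root (g%:R : 'F_p))%R.

Definition prime_power_sum (n t : nat) : Prop :=
  exists (p a : 'I_t -> nat),
    [/\ injective p,
        forall i, prime (p i) && (p i %| n),
        forall i, 0 < a i
      & n = \sum_(i < t) p i ^ a i].

(* primes 0 is empty, so the first conjunct also forces 0 < n. *)
Definition weakly_prime_additive (n : nat) : Prop :=
  1 < size (primes n) /\ exists t, prime_power_sum n t.

(* The least t with prime_power_sum n t; 0 is a junk value when there is
   none, which does not happen for weakly prime-additive n. *)
Definition kappa (n : nat) : nat :=
  match pselect (exists t, `[< prime_power_sum n t >]) with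
  | left ex_t => ex_minn ex_t
  | right _ => 0
  end.

Lemma kappaP (n t : nat) : weakly_prime_additive n ->
  kappa n = t <->
  prime_power_sum n t /\ (forall u, prime_power_sum n u -> t <= u).
Proof.
case=> _ [t0 nt0]; rewrite /kappa; case: pselect => [ex_t|[]]; last first.
  by exists t0; apply/asboolP.
case: ex_minnP => k /asboolP nk k_min; split=> [<-|[nt t_min]].
  by split=> // u nu; apply/k_min/asboolP.
by apply/eqP; rewrite eqn_leq t_min // k_min //; apply/asboolP.
Qed.

(* Main.v *)
Require Import Defs.
From mathcomp Require Import all_boot all_order all_algebra.
From mathcomp Require Import boolp classical_sets cardinality.
From mathcomp Require Import cyclic finfield zify.

Set Implicit Arguments.
Unset Strict Implicit.
Unset Printing Implicit Defensive.

Import GRing.Theory Num.Theory.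

(** Replacing m by M = 8m, it is enough to find arbitrarily large multiples n
    of M that are sums of four prime powers, because a multiple of 8 is never a
    sum of fewer.

    Lower bound on the length.  The critical case is that of three primes.
    As n is even, one of them is 2, so n = 2^a + q^b + r^c with q and r odd.
    Reducing n modulo q and modulo r gives (r/q)^c = (-2^a/q) and
    (q/r)^b = (-2^a/r).  Quadratic reciprocity links the two left hand
    sides, the right hand sides depend only on q and r modulo 8 and on the
    parity of a, and no class of (2^a, q^b, r^c) modulo 8 with sum 0 satisfies
    all these constraints ([sum3_not_dvd8]).

    Construction.  The number is n = p^e + q + r + s, built as follows.
    - q and r are primes congruent to -1 modulo M, with r = 1 modulo q; set
      N = q + r and F = M q r.  The residue of r modulo q and the inequality
      q + 1 < r make N + 1 invertible modulo F.
    - p is a prime congruent to 1 modulo F for which N is not a square.  It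
      exists because N = 6 modulo 8, so that N/2 is 3 modulo 4, hence not a
      square.  All powers of p are 1 modulo F.
    - s is a prime with s = -(1 + N) modulo F, s = -N modulo p, and p a
      primitive root modulo s.
    Then F divides n for every exponent e, p divides n because it divides
    N + s, and as p is a primitive root the exponents e with p^e = -N
    modulo s form an arithmetic progression, for which s divides n too.

    The hypothesis yields s because the symbol to be checked is (p/x) for some
    x = -N modulo p, and since p = 1 modulo 4 this is (x/p) = (N/p) = -1.

    The primes q, r and p come from the same hypothesis: it yields a prime in
    any class a modulo f, with 4 | f, whose representative a is coprime to f
    and not a square ([prime_in_progression]).  For such an a some odd prime g
    has (g/a) = -1, and the hypothesis applies to that g. *)

(** * Euler's criterion *)

Definition legendre (x p : nat) : int := kronecker_prime x%:Z p.

Lemma odd_prime_half p : prime p -> odd p -> 0 < p./2 /\ p = (p./2).*2.+1.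
Proof.
move=> /prime_gt1 p_gt1 odd_p.
by have := odd_double_half p; rewrite odd_p; lia.
Qed.

Lemma natF_eq0 p x : prime p -> ((x%:R : 'F_p) == 0)%R = (p %| x).
Proof. by move=> pp; rewrite -(dvdn_pcharf (pchar_Fp pp)). Qed.

Lemma natF_eqmod p x y : prime p ->
  ((x%:R : 'F_p) == y%:R)%R = (x == y %[mod p]).
Proof.
move=> pp; apply/eqP/eqP => [xy|xy].
  by rewrite -!(val_Fp_nat pp) xy.
by rewrite -(Fp_nat_mod pp) xy Fp_nat_mod.
Qed.

Lemma expF_pred p (x : 'F_p) : prime p -> (x != 0 -> x ^+ p.-1 = 1)%R.
Proof.
move=> pp x0; apply: (mulfI x0).
rewrite mulr1 -exprS prednK ?prime_gt0 //.
by rewrite -[in X in (_ ^+ X)%R](card_Fp pp) expf_card.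
Qed.

(** The p - 1 nonzero elements are all roots of unity of order dividing
    p - 1, and in a field this many such roots include a primitive one. *)
Lemma exists_primitive_root p : prime p ->
  exists z : 'F_p, (p.-1).-primitive_root%R z.
Proof.
move=> pp.
have /hasP[z _ zP] :
    has (p.-1).-primitive_root%R [seq x <- enum 'F_p | x != 0%R].
  apply: has_prim_root.
  - by have := prime_gt1 pp; lia.
  - apply/allP => x; rewrite mem_filter unity_rootE => /andP[x0 _].
    by rewrite expF_pred.
  - by rewrite filter_uniq // enum_uniq.
  - rewrite size_filter -[X in X.-1](card_Fp pp).
    have := count_predC (pred1 (0%R : 'F_p)) (enum 'F_p).
    rewrite -cardE => <-; rewrite count_uniq_mem ?enum_uniq //=.
    by rewrite (eq_count (a2 := predC (pred1 0%R))) //; case: (_ \in _); lia.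
by exists z.
Qed.

(** Euler's criterion.  The halved power of a nonzero x squares to 1, so it is
    1 or -1; when it is 1, writing x = z^i for a primitive root z shows that i
    is even, which exhibits a square root of x. *)
Lemma legendreE p x : prime p -> odd p ->
  ((legendre x p)%:~R = x%:R ^+ p./2 :> 'F_p)%R.
Proof.
move=> pp odd_p; have [h_gt0 pE] := odd_prime_half pp odd_p.
have h2 : p./2 * 2 = p.-1 by lia.
rewrite /legendre /kronecker_prime -[(p%:Z %| _)%Z]/(p %| x).
case: eqP => [p2|_]; first by rewrite p2 in odd_p.
have [px|px] := boolP (p %| x).
  have /eqP-> : (x%:R : 'F_p)%R == 0%R by rewrite natF_eq0.
  by rewrite expr0n; case: (p./2) h_gt0.
have x0 : (x%:R : 'F_p)%R != 0%R by rewrite natF_eq0.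
have x2 : (x%:R ^+ p./2 = 1 :> 'F_p)%R \/ (x%:R ^+ p./2 = -1 :> 'F_p)%R.
  have : ((x%:R ^+ p./2) ^+ 2 == 1 :> 'F_p)%R.
    by rewrite -exprM h2 expF_pred.
  by rewrite sqrf_eq1 => /orP[/eqP->|/eqP->]; [left|right].
case: ifP => [/existsP[y /eqP xy]|noroot].
  have yx : (y ^+ 2 = x%:R)%R by rewrite xy.
  have y0 : (y != 0)%R by apply: contraNneq x0 => y0; rewrite -yx y0 expr0n.
  by rewrite -yx -exprM mulnC h2 expF_pred.
case: x2 => [x1|->//].
have [z zP] := exists_primitive_root pp.
have [i xz] := prim_rootP zP (expF_pred pp x0).
move: x1; rewrite xz -exprM => /eqP; rewrite -(prim_order_dvd zP).
rewrite -[X in X %| _]h2 [p./2 * 2]mulnC dvdn_pmul2r // => /dvdnP[j ij].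
move/negbT/negP: noroot; case; apply/existsP; exists (z ^+ j)%R.
by rewrite -exprM -ij -xz.
Qed.

Lemma legendre_val p x :
  [\/ legendre x p = 0, legendre x p = 1 | legendre x p = -1]%R.
Proof.
rewrite /legendre /kronecker_prime.
do 4?[case: ifP => _];
  first [by constructor 1 | by constructor 2 | by constructor 3].
Qed.

Lemma oneF_neqN1 p : prime p -> odd p -> (1 != -1 :> 'F_p)%R.
Proof.
move=> pp odd_p; have [h_gt0 pE] := odd_prime_half pp odd_p.
rewrite -subr_eq0 opprK -(natrD _ 1 1) natF_eq0 //.
by apply/negP => /dvdn_leq; lia.
Qed.

(** In odd characteristic 0, 1 and -1 stay distinct, so identities between
    Legendre symbols can be checked in the prime field, where
    [legendreE] turns them into identities between powers. *)
Lemma legendre_inj p (x y : int) : prime p -> odd p ->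
  ([\/ x = 0, x = 1 | x = -1] -> [\/ y = 0, y = 1 | y = -1] ->
  x%:~R = y%:~R :> 'F_p -> x = y)%R.
Proof.
move=> pp odd_p; have n1 := oneF_neqN1 pp odd_p.
have n0 : (1 != 0 :> 'F_p)%R by exact: oner_neq0.
have n2 : (-1 != 0 :> 'F_p)%R by rewrite oppr_eq0.
by case=> ->; case=> -> // /eqP; rewrite ?mulr0z ?mulr1z ?mulrN1z ?mulNrz
  ?[(0 == _)%R]eq_sym ?[(-1 == 1)%R]eq_sym
  ?(negbTE n0) ?(negbTE n1) ?(negbTE n2).
Qed.

Lemma legendre_eqE p x y : prime p -> odd p ->
  (x%:R ^+ p./2 = y%:R ^+ p./2 :> 'F_p)%R -> legendre x p = legendre y p.
Proof.
move=> pp odd_p xy; apply: (legendre_inj pp odd_p); try exact: legendre_val.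
by rewrite !legendreE.
Qed.

Lemma legendre_eqmod p x y : prime p -> odd p -> x = y %[mod p] ->
  legendre x p = legendre y p.
Proof.
move=> pp odd_p /eqP; rewrite -natF_eqmod // => /eqP xy.
by apply: legendre_eqE => //; rewrite xy.
Qed.

Lemma legendreM p x y : prime p -> odd p ->
  (legendre (x * y) p = legendre x p * legendre y p)%R.
Proof.
move=> pp odd_p; apply: (legendre_inj pp odd_p); first exact: legendre_val.
  case: (legendre_val p x) => ->; case: (legendre_val p y) => ->;
    first [by constructor 1 | by constructor 2 | by constructor 3].
by rewrite rmorphM /= !legendreE // natrM exprMn.
Qed.

Lemma legendre1 p : prime p -> odd p -> legendre 1 p = 1%R.
Proof.
move=> pp odd_p; apply: (legendre_inj pp odd_p); first exact: legendre_val.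
  by constructor 2.
by rewrite legendreE // expr1n.
Qed.

Lemma legendreX p x k : prime p -> odd p ->
  (legendre (x ^ k) p = legendre x p ^+ k)%R.
Proof.
move=> pp odd_p; elim: k => [|k IHk]; first by rewrite expr0 legendre1.
by rewrite expnS legendreM // IHk exprS.
Qed.

Lemma legendre_neq0 p x : prime p -> odd p ->
  (legendre x p != 0)%R = ~~ (p %| x).
Proof.
move=> pp odd_p; have [h_gt0 pE] := odd_prime_half pp odd_p.
have -> : (legendre x p == 0)%R = ((legendre x p)%:~R == 0 :> 'F_p)%R.
  apply/eqP/eqP => [->//|L0].
  by apply: (legendre_inj pp odd_p); [exact: legendre_val|constructor 1|].
by rewrite legendreE // expf_eq0 h_gt0 natF_eq0.
Qed.

(** A primitive root z is a nonresidue: z to the power (p - 1)/2 is not 1. *)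
Lemma exists_nonresidue p : prime p -> odd p -> exists u, legendre u p = (-1)%R.
Proof.
move=> pp odd_p; have [h_gt0 pE] := odd_prime_half pp odd_p.
have [z zP] := exists_primitive_root pp.
have zE : (nat_of_ord z)%:R%R = z.
  apply: val_inj; rewrite /= val_Fp_nat // modn_small //.
  by rewrite -[ltnRHS](card_Fp pp) card_ord ltn_ord.
exists z; have z0 : ~~ (p %| z).
  rewrite -natF_eq0 // zE; apply/eqP => z0; have := prim_expr_order zP.
  rewrite z0 expr0n; have -> : (p.-1 == 0) = false by lia.
  by move/eqP; rewrite eq_sym oner_eq0.
have := legendreE z pp odd_p; rewrite zE.
case: (legendre_val p z) => // Lz.
  by move: z0; rewrite -(legendre_neq0 z pp odd_p) Lz.
move/esym/eqP; rewrite Lz mulr1z -(prim_order_dvd zP) => /dvdn_leq; lia.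
Qed.

(** This is (-y/p) = (-1/p) (y/p), with -y represented by any natural number
    x such that x + y is a multiple of p. *)
Lemma legendreN p x y : prime p -> odd p -> p %| x + y ->
  (legendre x p = (-1) ^+ p./2 * legendre y p)%R.
Proof.
move=> pp odd_p pxy; apply: (legendre_inj pp odd_p); first exact: legendre_val.
  rewrite -signr_odd; case: (odd _); case: (legendre_val p y) => ->;
    first [by constructor 1 | by constructor 2 | by constructor 3].
rewrite rmorphM /= rmorphXn /= mulrN1z !legendreE // -exprMn mulN1r.
congr (_ ^+ _)%R.
by apply/eqP; rewrite -addr_eq0 -natrD natF_eq0.
Qed.

(** * Quadratic reciprocity *)

(** The distance from x to the nearest multiple of p, for odd p: up to sign,
    x has a unique representative between 0 and (p - 1)/2. *)
Definition abs_residue (p x : nat) : nat :=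
  if p./2 < x %% p then p - x %% p else x %% p.

(** If a k and a l have the same distance to the multiples of p, then p divides
    a (k - l) or a (k + l), hence k - l or k + l; for k and l between 1 and
    (p - 1)/2 this forces k = l. *)
Lemma perm_abs_residue p a : prime p -> odd p -> ~~ (p %| a) ->
  perm_eq [seq abs_residue p (a * k) | k <- iota 1 p./2] (iota 1 p./2).
Proof.
move=> pp odd_p pa; have [h_gt0 pE] := odd_prime_half pp odd_p.
have small k : k \in iota 1 p./2 -> 0 < k <= p./2.
  by rewrite mem_iota; lia.
have ak0 k : k \in iota 1 p./2 -> 0 < (a * k) %% p < p.
  move=> /small k_h; rewrite ltn_mod (prime_gt0 pp) andbT lt0n -/(p %| a * k).
  by rewrite Euclid_dvdM // negb_or pa /=; apply/negP => /dvdn_leq; lia.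
have eq_le k l : k \in iota 1 p./2 -> l \in iota 1 p./2 -> l <= k ->
    (a * k) %% p = (a * l) %% p -> k = l.
  move=> /small k_h /small l_h le_lk /eqP.
  rewrite eqn_mod_dvd ?leq_mul2l ?le_lk ?orbT // -mulnBr Euclid_dvdM //.
  rewrite (negbTE pa) /= => kl; apply/eqP; rewrite eqn_leq le_lk andbT -subn_eq0.
  by rewrite -leqn0 leqNgt; apply/negP => /dvdn_leq/(_ kl); lia.
have uniq_abs : uniq [seq abs_residue p (a * k) | k <- iota 1 p./2].
  rewrite map_inj_in_uniq ?iota_uniq // => k l k_in l_in kl.
  have := small _ k_in; have := small _ l_in => l_h k_h.
  have := ak0 _ k_in; have := ak0 _ l_in => al0 ak0'.
  have : (a * k) %% p = (a * l) %% p \/ (a * k) %% p + (a * l) %% p = p.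
    by move: kl; rewrite /abs_residue; do 2!case: ifP; lia.
  case=> [akl|akl].
    by case: (leqP l k) => [|/ltnW] le; [|apply/esym]; apply: eq_le.
  have : p %| a * (k + l) by rewrite mulnDr /dvdn -modnDm akl modnn.
  by rewrite Euclid_dvdM // (negbTE pa) /= => /dvdn_leq; lia.
apply: uniq_perm => //; first exact: iota_uniq.
have sub :
    {subset [seq abs_residue p (a * k) | k <- iota 1 p./2] <= iota 1 p./2}.
  move=> x /mapP[k k_in ->]; have := ak0 _ k_in; rewrite mem_iota /abs_residue.
  by case: ifP; lia.
by have [_] := uniq_min_size uniq_abs sub (eq_leq (esym (size_map _ _))).
Qed.

(** Gauss's lemma.  The product of the a k over 1 <= k <= (p - 1)/2 is
    a^((p-1)/2) times the product of the k, and it is also, by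
    [perm_abs_residue], the product of the k up to one sign for each a k whose
    residue exceeds p/2. *)
Lemma legendre_gauss p a : prime p -> odd p -> ~~ (p %| a) ->
  (legendre a p =
   (-1) ^+ (\sum_(k <- iota 1 p./2) (p./2 < (a * k) %% p))%N)%R.
Proof.
move=> pp odd_p pa; have [h_gt0 pE] := odd_prime_half pp odd_p.
apply: (legendre_inj pp odd_p); first exact: legendre_val.
  rewrite -signr_odd; case: (odd _);
    first [by constructor 2 | by constructor 3].
rewrite rmorphXn /= mulrN1z legendreE //.
pose P : 'F_p := (\prod_(k <- iota 1 p./2) k%:R)%R.
have P0 : (P != 0)%R.
  rewrite /P prodf_seq_neq0; apply/allP => k; rewrite mem_iota => k_h /=.
  by rewrite natF_eq0 //; apply/negP => /dvdn_leq; lia.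
apply: (mulIf P0).
have <- : (\prod_(k <- iota 1 p./2) (a * k)%:R = a%:R ^+ p./2 * P :> 'F_p)%R.
  under eq_bigr do rewrite natrM.
  by rewrite big_split /= big_const_seq count_predT size_iota -Monoid.iteropE.
rewrite /P -[X in _ = (_ * X)%R](perm_big _ (perm_abs_residue pp odd_p pa)) /=.
rewrite big_map -prodrXr -big_split /=; apply: eq_bigr => k _.
rewrite /abs_residue -(Fp_nat_mod pp (a * k)).
case: ifP => _; rewrite ?expr0 ?mul1r // expr1 mulN1r natrB; last first.
  by rewrite ltnW // ltn_mod prime_gt0.
by rewrite pchar_Fp_0 // sub0r opprK.
Qed.

(** Modulo 2, the number of sign changes in Gauss's lemma can be read off the
    division of each a k by p: since p is odd, a k has the parity of its
    quotient plus its absolute residue plus its sign change, and the absolute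
    residues have the same sum as the k.  For odd a only the quotients
    remain, and for a = 2 only the sum of the k. *)
Lemma legendre_eisenstein p a : prime p -> odd p -> ~~ (p %| a) ->
  (legendre a p =
   (-1) ^+ (a.+1 * \sum_(k <- iota 1 p./2) k +
             \sum_(k <- iota 1 p./2) (a * k) %/ p)%N)%R.
Proof.
move=> pp odd_p pa; rewrite legendre_gauss // -signr_odd -[RHS]signr_odd.
congr (_ ^+ nat_of_bool _)%R.
have sum_abs :
    \sum_(k <- iota 1 p./2) k =
    \sum_(k <- iota 1 p./2) abs_residue p (a * k).
  by rewrite -[LHS](perm_big _ (perm_abs_residue pp odd_p pa)) big_map.
rewrite mulSn {1}sum_abs big_distrr /= -!big_split /=.
rewrite !(big_morph odd oddD erefl); apply: eq_bigr => k _.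
have := congr1 odd (divn_eq (a * k) p).
rewrite !oddD [odd (_ * p)]oddM odd_p andbT => ->; rewrite /abs_residue.
have r_lt : (a * k) %% p < p by rewrite ltn_mod prime_gt0.
case: ifP => _; rewrite ?oddB ?(ltnW r_lt) // ?odd_p /=;
  by case: (odd _); case: (odd _).
Qed.

Lemma iota1_rcons h : iota 1 h.+1 = rcons (iota 1 h) h.+1.
Proof. by rewrite -(addn1 h) iotaD cats1 add1n addn1. Qed.

(** In [legendre_eisenstein] with a = 2 all quotients are 0, so the sign is that
    of 1 + ... + (p - 1)/2, whose parity depends only on p modulo 8. *)
Lemma legendre2 p : prime p -> odd p ->
  (legendre 2 p = (-1) ^+ ((p %% 8 == 3) || (p %% 8 == 5))%N)%R.
Proof.
move=> pp odd_p; have [h_gt0 pE] := odd_prime_half pp odd_p.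
rewrite legendre_eisenstein //; last by apply/negP => /dvdn_leq; lia.
rewrite [X in _ + X]big_seq_cond [X in _ + X]big1 ?addn0; last first.
  by move=> k; rewrite mem_iota andbT => k_h; apply: divn_small; lia.
rewrite -signr_odd oddM /=; congr (_ ^+ nat_of_bool _)%R.
have sumE : (\sum_(k <- iota 1 p./2) k).*2 = p./2 * (p./2).+1.
  elim: (p./2) => [|h IHh]; first by rewrite big_nil.
  rewrite iota1_rcons big_rcons /=; lia.
move: (bigop _ _ _) sumE => S; move: (p./2) pE {h_gt0} => h pE.
have [j [hE|hE|hE|hE]] : exists j,
    [\/ h = 4 * j, h = 4 * j + 1, h = 4 * j + 2 | h = 4 * j + 3].
  exists (h %/ 4); have := divn_eq h 4; have : h %% 4 < 4 by rewrite ltn_mod.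
  case: (h %% 4) => [|[|[|[|//]]]] _ hE;
    [constructor 1|constructor 2|constructor 3|constructor 4]; lia.
all: by rewrite pE hE => sumS; lia.
Qed.

(** A quotient n / p known to be at most h counts the multiples of p up to n
    among p, 2p, ..., hp; this turns quotients into lattice points. *)
Lemma divn_count p n h : 0 < p -> n %/ p <= h ->
  n %/ p = \sum_(l <- iota 1 h) (l * p <= n).
Proof.
move=> p_gt0 nh; rewrite -[LHS](minn_idPr nh).
under eq_bigr do rewrite -leq_divRL //.
move: (n %/ p) => x; elim: h {nh} => [|h IHh]; first by rewrite big_nil min0n.
rewrite iota1_rcons big_rcons /=; lia.
Qed.

(** Eisenstein's lattice count.  By [legendre_eisenstein] the exponent is a sum
    of quotients, which counts the points (k, l) of the rectangle
    [1, (p-1)/2] x [1, (q-1)/2] below the diagonal l p = k q for one symbol and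
    above it for the other; no point lies on the diagonal. *)
Lemma quadratic_reciprocity p q :
  prime p -> odd p -> prime q -> odd q -> p != q ->
  (legendre p q * legendre q p = (-1) ^+ (p./2 * q./2)%N)%R.
Proof.
move=> pp odd_p pq odd_q neq_pq.
have [hp_gt0 pE] := odd_prime_half pp odd_p.
have [hq_gt0 qE] := odd_prime_half pq odd_q.
have pNq : ~~ (p %| q) by rewrite dvdn_prime2.
have qNp : ~~ (q %| p) by rewrite dvdn_prime2 // eq_sym.
rewrite !legendre_eisenstein // -exprD.
rewrite -[LHS]signr_odd -[RHS]signr_odd; congr (_ ^+ nat_of_bool _)%R.
rewrite !mulSn !oddD !(oddM p, oddM q) odd_p odd_q !addbb !addFb -oddD.
congr odd.
have in_h h k : k \in iota 1 h -> 0 < k <= h by rewrite mem_iota; lia.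
have floors r s : prime r -> prime s -> odd r -> odd s ->
    \sum_(k <- iota 1 r./2) (s * k) %/ r =
    \sum_(k <- iota 1 r./2) \sum_(l <- iota 1 s./2) (l * r <= s * k).
  move=> pr ps odd_r odd_s; apply: eq_big_seq => k /in_h k_h.
  have [[_ rE] [_ sE]] := (odd_prime_half pr odd_r, odd_prime_half ps odd_s).
  by apply: divn_count; [lia | rewrite -ltnS ltn_divLR; nia].
rewrite !floors // exchange_big /= -big_split /=.
under eq_big_seq => k k_in.
  rewrite -big_split /=; under eq_big_seq => l l_in.
    have -> : (k * q <= p * l) + (l * p <= q * k) = 1.
      have : l * p != q * k.
        apply/negP => /eqP lk; have /dvdn_leq : p %| k.
          by rewrite -(Gauss_dvdr (n := q)) -?lk ?dvdn_mull // prime_coprime.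
        by have := in_h _ _ k_in; lia.
      by rewrite [k * q]mulnC [p * l]mulnC; case: ltngtP.
    over.
  rewrite sum1_size size_iota. over.
by rewrite big_const_seq count_predT size_iota iter_addn_0 mulnC.
Qed.

(** * Kronecker symbols and primes in arithmetic progressions *)

Lemma kronecker_nat (x n : nat) : 0 < n ->
  (kronecker x n = \prod_(l <- primes n) legendre x l ^+ logn l n)%R.
Proof. by case: n => // n _; rewrite /kronecker mul1r. Qed.

Lemma primes_odd n l : odd n -> l \in primes n -> prime l && odd l.
Proof.
move=> odd_n; rewrite mem_primes => /and3P[pl n0 ln]; rewrite pl.
exact: dvdn_odd ln odd_n.
Qed.

Lemma kroneckerM n x y : odd n ->
  (kronecker (x * y)%N n = kronecker x n * kronecker y n)%R.
Proof.
move=> odd_n; rewrite !kronecker_nat ?odd_gt0 // -big_split /=.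
apply: eq_big_seq => l /(primes_odd odd_n)/andP[pl odd_l].
by rewrite legendreM // exprMn.
Qed.

Lemma kronecker1 n : odd n -> (kronecker 1%N n = 1)%R.
Proof.
move=> odd_n; rewrite kronecker_nat ?odd_gt0 // big_seq big1 // => l.
by move=> /(primes_odd odd_n)/andP[pl odd_l]; rewrite legendre1 // expr1n.
Qed.

Lemma kronecker_neq0 n x : odd n -> (kronecker (x : nat) n != 0)%R ->
  coprime x n.
Proof.
move=> odd_n; have n_gt0 := odd_gt0 odd_n; apply: contraR.
rewrite /coprime => gcd_neq1; set g := pdiv (gcdn x n).
have pg : prime g.
  by rewrite pdiv_prime // ltn_neqAle eq_sym gcd_neq1 gcdn_gt0 n_gt0 orbT.
have /andP[gx gn] : (g %| x) && (g %| n) by rewrite -dvdn_gcd pdiv_dvd.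
have g_in : g \in primes n by rewrite mem_primes pg n_gt0.
rewrite kronecker_nat // (big_rem g g_in) /=.
have /eqP -> : legendre x g == 0%R.
  by rewrite -[_ == _]negbK legendre_neq0 ?gx // (dvdn_odd gn).
move: g_in; rewrite -logn_gt0 expr0n.
by case: (logn g n) => // k _; rewrite mul0r.
Qed.

Lemma kronecker_eqmod n x y : odd n -> x = y %[mod n] ->
  kronecker (x : nat) n = kronecker (y : nat) n.
Proof.
move=> odd_n xy; rewrite !kronecker_nat ?odd_gt0 //.
apply: eq_big_seq => l l_in; have /andP[pl odd_l] := primes_odd odd_n l_in.
rewrite (@legendre_eqmod l x y) //.
have ln : l %| n by move: l_in; rewrite mem_primes => /and3P[].
by rewrite -(modn_dvdm x ln) xy modn_dvdm.
Qed.

(** For p = 1 modulo 4 the reciprocity sign is 1 at every prime factor of n,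
    so the Jacobi symbol (p/n) can be swapped factor by factor. *)
Lemma kronecker_reciprocity p n : prime p -> p %% 4 = 1 -> odd n ->
  kronecker p n = legendre n p.
Proof.
move=> pp p4 odd_n; have n_gt0 := odd_gt0 odd_n.
have odd_p : odd p by lia.
rewrite kronecker_nat // [in RHS](prod_prime_decomp n_gt0).
rewrite prime_decompE big_map /=.
have morphM : {morph legendre^~ p : x y / x * y >-> (x * y)%R}.
  by move=> x y /=; rewrite legendreM.
rewrite (big_morph (legendre^~ p) morphM (legendre1 pp odd_p)).
apply: eq_big_seq => l /(primes_odd odd_n)/andP[pl odd_l].
rewrite legendreX //; congr (_ ^+ _)%R.
have [->//|neq_pl] := eqVneq p l.
have := quadratic_reciprocity pp odd_p pl odd_l neq_pl.
have -> : p./2 = 2 * (p %/ 4) by lia.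
rewrite -mulnA exprM sqrrN !expr1n.
by case: (legendre_val l p) => ->; case: (legendre_val p l) => ->.
Qed.

Lemma nonsquare_odd_logn n : 0 < n -> (forall y, n <> y ^ 2) ->
  exists l, prime l /\ odd (logn l n).
Proof.
move=> n_gt0 nsq; have [/hasP[l l_in odd_l]|/hasPn ev] :=
    boolP (has (fun l => odd (logn l n)) (primes n)).
  by exists l; split=> //; move: l_in; rewrite mem_primes => /andP[].
case: (nsq (\prod_(l <- primes n) l ^ (logn l n)./2)).
rewrite {1}[n]prod_prime_decomp // prime_decompE big_map /=.
rewrite (big_morph (fun x => x ^ 2) (id1 := 1) (op1 := muln)) //; last first.
  by move=> x y /=; rewrite expnMn.
apply: eq_big_seq => l /ev/negbTE ev_l.
by rewrite -expnM muln2 even_halfK ?ev_l.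
Qed.

(** Choose x to be a nonresidue at one prime l that divides n to an odd power,
    and 1 modulo F and modulo the part of n prime to l: only l contributes
    to (x/n). *)
Lemma exists_kroneckerN1 n F : odd n -> (forall y, n <> y ^ 2) -> coprime F n ->
  exists x, x = 1 %[mod F] /\ kronecker x n = (-1)%R.
Proof.
move=> odd_n nsq copFn; have n_gt0 := odd_gt0 odd_n.
have [l [pl odd_logn]] := nonsquare_odd_logn n_gt0 nsq.
have e_gt0 : 0 < logn l n by case: (logn l n) odd_logn.
have l_in : l \in primes n by rewrite -logn_gt0.
have /andP[_ odd_l] := primes_odd odd_n l_in.
have [u uN] := exists_nonresidue pl odd_l.
have cop : coprime l (n`_l^' * F).
  rewrite coprimeMr; apply/andP; split.
    by rewrite -(coprime_pexpl _ _ e_gt0) -p_part coprime_partC.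
  rewrite coprime_sym; apply: coprime_dvdr copFn.
  by move: l_in; rewrite mem_primes => /and3P[].
pose x := chinese l (n`_l^' * F) u 1.
have xl : x = u %[mod l] by exact: chinese_modl.
have xF : x = 1 %[mod n`_l^' * F] by exact: chinese_modr.
have x1 d : d %| n`_l^' * F -> x = 1 %[mod d].
  by move=> dF; rewrite -(modn_dvdm x dF) xF modn_dvdm.
exists x; split; first by apply/x1/dvdn_mull.
rewrite kronecker_nat // (bigD1_seq l) ?primes_uniq //=.
rewrite (legendre_eqmod pl odd_l xl) uN -signr_odd odd_logn expr1.
rewrite big_seq_cond big1 ?mulr1 // => i /andP[i_in neq_il].
have /andP[pi odd_i] := primes_odd odd_n i_in.
rewrite (@legendre_eqmod i x 1) ?legendre1 ?expr1n //; apply/x1/dvdn_mulr.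
have : i %| n by move: i_in; rewrite mem_primes => /and3P[].
rewrite -[n in _ %| n](partnC l) // p_part Euclid_dvdM //.
by rewrite Euclid_dvdX // dvdn_prime2 // (negbTE neq_il).
Qed.

Lemma mulz_eqN1 (x y : int) : (x * y = -1 -> x = -1 \/ y = -1)%R.
Proof.
move=> xy; have /eqP := congr1 absz xy.
rewrite abszM muln_eq1 => /andP[/eqP x1 _].
have [] : (x = 1 \/ x = -1)%R by lia.
  by move=> x_1; right; rewrite x_1 mul1r in xy.
by move=> ->; left.
Qed.

(** By multiplicativity some prime factor of x inherits the symbol -1. *)
Lemma exists_prime_kroneckerN1 n x : odd n -> odd x -> kronecker x n = (-1)%R ->
  exists g, [/\ prime g, odd g & kronecker g n = (-1)%R].
Proof.
move=> odd_n; elim/ltn_ind: x => x IHx odd_x xN.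
have x_neq1 : x != 1 by apply: contra_eqN xN => /eqP->; rewrite kronecker1.
have x_gt0 := odd_gt0 odd_x.
have pg : prime (pdiv x) by apply: pdiv_prime; lia.
have gx := pdiv_dvd x.
have xE : x = pdiv x * (x %/ pdiv x) by rewrite mulnC divnK.
move: xN; rewrite {1}xE kroneckerM // => /mulz_eqN1[gN|yN].
  by exists (pdiv x); split=> //; exact: dvdn_odd gx odd_x.
apply: (IHx _ _ _ yN); first by rewrite ltn_Pdiv // prime_gt1.
by move: odd_x; rewrite {1}xE oddM => /andP[].
Qed.

Definition primitive_root_hypothesis : Prop :=
  forall a f g : nat,
    1 <= a <= f -> gcdn a f = 1 -> 4 %| f ->
    prime g -> odd g -> g %| f ->
    kronecker g%:Z a%:Z = (-1)%R ->
    exists p : nat,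
      [/\ prime p, p = a %[mod f] & primitive_root_mod g p].

(** A substitute for Dirichlet's theorem: the hypothesis needs an odd prime g
    with (g/a) = -1, which exists when a is odd and not a square, and g may
    then be adjoined to the modulus since it is coprime to a. *)
Lemma prime_in_progression a f : primitive_root_hypothesis ->
  coprime a f -> 4 %| f -> (forall y, a <> y ^ 2) ->
  exists2 p, prime p & p = a %[mod f].
Proof.
move=> star cop f4 nsq.
have a_gt0 : 0 < a by case: a nsq {cop} => // /(_ 0).
have f_gt1 : 1 < f.
  case: f f4 cop => [_|[|[|//]]] //; rewrite /coprime gcdn0 => /eqP a1.
  by case: (nsq 1).
have cop4 : coprime a 4 by exact: coprime_dvdr cop.
have odd_a : odd a by rewrite -coprimen2 (coprime_dvdr _ cop4).
have [x [x4 xN]] :=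
  exists_kroneckerN1 odd_a nsq (etrans (coprime_sym _ _) cop4).
have odd_x : odd x by move: x4; lia.
have [g [pg odd_g gN]] := exists_prime_kroneckerN1 odd_a odd_x xN.
have cop_ga : coprime g a by apply: kronecker_neq0 => //; rewrite gN.
(* the hypothesis wants a below its modulus, hence the power of f *)
have a_lt : a < f ^ a by exact: ltn_expl.
have f_dvd : f %| f ^ a by exact: dvdn_exp.
have [||||p [pp pa _]] := star a (f ^ a * g) g _ _ _ pg odd_g _ gN.
- by rewrite a_gt0 (leq_trans (ltnW a_lt)) // leq_pmulr // prime_gt0.
- by apply/eqP; rewrite -/(coprime _ _) coprimeMr coprimeXr //= coprime_sym.
- by rewrite dvdn_mulr // (dvdn_trans f4).
- exact: dvdn_mull.
exists p => //; have f_dvd' : f %| f ^ a * g by exact: dvdn_mulr.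
by rewrite -(modn_dvdm p f_dvd') pa modn_dvdm.
Qed.

(** * Sums of three prime powers *)

Lemma legendre_sign p x : prime p -> odd p -> ~~ (p %| x) ->
  exists b : bool, legendre x p = ((-1) ^+ b)%R.
Proof.
move=> pp odd_p; rewrite -legendre_neq0 //.
by case: (legendre_val p x) => -> // _; [exists false | exists true].
Qed.

Lemma odd_mod8 x : odd x -> x %% 8 \in [:: 1; 3; 5; 7].
Proof. by rewrite !inE; lia. Qed.

Lemma odd_half_mod8 x : odd x./2 = (x %% 8 \in [:: 2; 3; 6; 7]).
Proof. by rewrite !inE; lia. Qed.

Lemma odd_expn_mod8 q b : odd q -> q ^ b %% 8 = if odd b then q %% 8 else 1.
Proof.
move=> odd_q; have q2 : q ^ 2 %% 8 = 1.
  have : q %% 8 < 8 by rewrite ltn_mod.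
  have : odd (q %% 8) by lia.
  by rewrite -modnXm; case: (q %% 8) => [|[|[|[|[|[|[|[|]]]]]]]].
have even_mod k : q ^ k.*2 %% 8 = 1 by rewrite -mul2n expnM -modnXm q2 exp1n.
rewrite -{1}(odd_double_half b); case: (odd b); last exact: even_mod.
by rewrite expnS -modnMm even_mod muln1 modn_mod.
Qed.

Lemma expn2_mod8 a : 0 < a ->
  2 ^ a %% 8 = if a == 1 then 2 else if a == 2 then 4 else 0.
Proof.
case: a => [|[|[|a]]] // _ /=.
by rewrite !expnS !mulnA modnMr.
Qed.

(** The relation (2/q)^a = (-1/q) (r/q)^c, written additively on the exponents
    of -1.  Both (2/q) and (-1/q) depend only on q modulo 8. *)
Lemma sum3_symbol q r a b c (s : bool) : prime q -> odd q -> 0 < b ->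
  q %| 2 ^ a + q ^ b + r ^ c -> legendre r q = ((-1) ^+ s)%R ->
  odd a && ((q %% 8 == 3) || (q %% 8 == 5)) = odd q./2 (+) (odd c && s).
Proof.
move=> pq odd_q b_gt0; rewrite addnAC dvdn_addl ?dvdn_exp // => q_dvd rqE.
have := legendreN pq odd_q q_dvd; rewrite !legendreX // legendre2 // rqE.
rewrite -!exprM -exprD -[LHS]signr_odd -[RHS]signr_odd => /signr_inj.
by rewrite oddD !oddM !oddb andbC [s && _]andbC.
Qed.

(** The obstruction to length three for multiples of 8: the two relations
    given by [sum3_symbol] and quadratic reciprocity only involve q and r
    modulo 8, the parities of a, b, c and whether a is 1, 2 or more, and a
    finite inspection finds no case where the sum is 0 modulo 8. *)
Lemma sum3_not_dvd8 q r a b c :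
  prime q -> odd q -> prime r -> odd r -> q != r ->
  0 < a -> 0 < b -> 0 < c ->
  q %| 2 ^ a + q ^ b + r ^ c -> r %| 2 ^ a + q ^ b + r ^ c ->
  ~~ (8 %| 2 ^ a + q ^ b + r ^ c).
Proof.
move=> pq odd_q pr odd_r neq_qr a_gt0 b_gt0 c_gt0 q_dvd r_dvd; apply/negP.
have [s sE] : exists s : bool, legendre r q = ((-1) ^+ s)%R.
  by apply: legendre_sign => //; rewrite dvdn_prime2.
have [t tE] : exists t : bool, legendre q r = ((-1) ^+ t)%R.
  by apply: legendre_sign => //; rewrite dvdn_prime2 // eq_sym.
have := sum3_symbol pq odd_q b_gt0 q_dvd sE.
rewrite addnAC in r_dvd; have := sum3_symbol pr odd_r c_gt0 r_dvd tE.
have := quadratic_reciprocity pq odd_q pr odd_r neq_qr.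
rewrite sE tE -exprD -[LHS]signr_odd -[RHS]signr_odd => /signr_inj.
rewrite oddD oddM !oddb => st.
(* from here on everything is expressed by residues modulo 8 and parities *)
rewrite /dvdn -modnDm -[(2 ^ a + _) %% 8]modnDm expn2_mod8 // !odd_expn_mod8 //.
move: st.
rewrite !odd_half_mod8.
move: (odd_mod8 odd_q) (odd_mod8 odd_r); move: (q %% 8) (r %% 8) => u v.
have [->|a1] := eqVneq a 1; [|have [->|a2] := eqVneq a 2].
all: rewrite !inE; do 2!case/or4P => /eqP->.
all: case: (odd b); case: (odd c); case: s {sE}; case: t {tE} => //=;
  by case: (odd a).
Qed.

(** * The auxiliary primes *)

Lemma eqmod_dvd d f x y : d %| f -> x = y %[mod f] -> x = y %[mod d].
Proof. by move=> df xy; rewrite -(modn_dvdm x df) xy modn_dvdm. Qed.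

Lemma coprime_eqmod f x y : x = y %[mod f] -> coprime x f = coprime y f.
Proof. by move=> xy; rewrite -coprime_modl xy coprime_modl. Qed.

Lemma dvdn_eqmod d x y z : x = y %[mod d] -> (d %| x + z) = (d %| y + z).
Proof. by move=> xy; rewrite /dvdn -modnDml xy modnDml. Qed.

Lemma mod4_3_nonsquare x : x %% 4 = 3 -> forall y, x <> y ^ 2.
Proof.
move=> x4 y xy; move: x4; rewrite xy -modnXm.
have : y %% 4 < 4 by rewrite ltn_mod.
by case: (y %% 4) => [|[|[|[|]]]].
Qed.

Lemma coprime_dvd_add f x y : f %| x + y -> coprime f y -> coprime f x.
Proof.
move=> fxy cop; rewrite /coprime -dvdn1 -(eqP cop) dvdn_gcd dvdn_gcdl /=.
by rewrite -(dvdn_addr y (dvdn_gcdr f x)) (dvdn_trans (dvdn_gcdl f x)).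
Qed.

(** A number that is -1 modulo M is 3 modulo 4, so it is not a square and its
    class contains primes; the second class is refined to be 1 modulo q. *)
Lemma exists_prime_pair M : primitive_root_hypothesis -> 4 %| M -> 0 < M ->
  exists q r, [/\ prime q, prime r, M %| q.+1, M %| r.+1 & r = 1 %[mod q]].
Proof.
move=> star M4 M_gt0.
have M3 : M.-1 %% 4 = 3 by lia.
have M1 x : x = M.-1 %[mod M] -> M %| x.+1.
  by move=> xM; rewrite -addn1 (dvdn_eqmod 1 xM) addn1 prednK.
have copM : coprime M.-1 M by rewrite coprime_sym coprimenP.
have [q pq /M1 qM] := prime_in_progression star copM M4 (mod4_3_nonsquare M3).
have copMq : coprime M q.
  rewrite coprime_sym; apply: (coprime_dvdr qM); exact: coprimenS.
pose a := chinese M q M.-1 1.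
have aM : a = M.-1 %[mod M] by exact: chinese_modl.
have aq : a = 1 %[mod q] by exact: chinese_modr.
have copa : coprime a (M * q).
  by rewrite coprimeMr (coprime_eqmod aM) (coprime_eqmod aq) copM coprime1n.
have a3 : a %% 4 = 3 by rewrite (eqmod_dvd M4 aM).
have [r pr ra] :=
  prime_in_progression star copa (dvdn_mulr _ M4) (mod4_3_nonsquare a3).
exists q, r; split=> //.
  exact/M1/(etrans (eqmod_dvd (dvdn_mulr _ (dvdnn M)) ra)).
exact: etrans (eqmod_dvd (dvdn_mull _ (dvdnn q)) ra) aq.
Qed.

(** Take p in a class x that is 1 modulo F and has (x/n) = -1.  Such an x is
    not a square, and since p = 1 modulo 4, (n/p) = (p/n) = (x/n). *)
Lemma exists_prime_nonresidue n F : primitive_root_hypothesis ->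
  odd n -> (forall y, n <> y ^ 2) -> 4 %| F -> coprime F n ->
  exists p, [/\ prime p, p = 1 %[mod F] & legendre n p = (-1)%R].
Proof.
move=> star odd_n nsq F4 copFn.
have [x [xF xN]] := exists_kroneckerN1 odd_n nsq copFn.
have copx : coprime x (F * n).
  by rewrite coprimeMr (coprime_eqmod xF) coprime1n kronecker_neq0 // xN.
have xnsq y : x <> y ^ 2.
  move=> xy; move: xN; rewrite xy expnS expn1 kroneckerM // => yN.
  by have := sqr_ge0 (kronecker y n); rewrite expr2 yN.
have [p pp px] := prime_in_progression star copx (dvdn_mulr _ F4) xnsq.
have pF : p = 1 %[mod F] by rewrite -xF; apply: eqmod_dvd px; exact: dvdn_mulr.
exists p; split=> //; rewrite -kronecker_reciprocity // ?(eqmod_dvd F4 pF) //.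
by rewrite -xN; apply: kronecker_eqmod => //;
  apply: eqmod_dvd px; exact: dvdn_mull.
Qed.

Lemma exists_oppn f x : 0 < f -> exists y, f %| y + x.
Proof.
by move=> f_gt0; exists (f * x - x); rewrite subnK ?dvdn_mulr // leq_pmull.
Qed.

(** The two congruences are solved by some a, and the hypothesis applies to a
    because (p/a) = (a/p) = (-N/p) = (N/p) = -1, where p = 1 modulo 4 is used
    twice.  The bound N < s makes s prime to N, so that -N is a power
    of p modulo s. *)
Lemma exists_prime_with_root F N p : primitive_root_hypothesis ->
  0 < F -> 4 %| F -> coprime F N.+1 -> prime p -> p = 1 %[mod F] ->
  legendre N p = (-1)%R ->
  exists s, [/\ prime s, N < s, F %| s + N.+1, p %| s + N
              & primitive_root_mod p s].
Proof.
move=> star F_gt0 F4 copFN pp pF Np.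
have p4 : p %% 4 = 1 by rewrite (eqmod_dvd F4 pF).
have odd_p : odd p by lia.
have p_half : p./2 = 2 * (p %/ 4) by lia.
have copFp : coprime F p by rewrite coprime_sym (coprime_eqmod pF) coprime1n.
have copNp : ~~ (p %| N) by rewrite -legendre_neq0 // Np.
have [u Fu] := exists_oppn N.+1 F_gt0.
have [v pv] := exists_oppn N (prime_gt0 pp).
(* the shift keeps a in its classes and makes s >= a exceed N *)
pose a := chinese F p u v + F * p * N.+1.
have aF : F %| a + N.+1.
  have au : a = u %[mod F].
    by rewrite /a -mulnA -modnDmr modnMr addn0 chinese_modl.
  by rewrite (dvdn_eqmod _ au).
have ap : p %| a + N.
  have av : a = v %[mod p].
    by rewrite /a mulnAC -modnDmr modnMl addn0 chinese_modr.
  by rewrite (dvdn_eqmod _ av).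
have N_lt_a : N < a.
  rewrite (@leq_trans (F * p * N.+1)) ?leq_addl //.
  by rewrite leq_pmull // muln_gt0 F_gt0 prime_gt0.
have a_gt0 : 0 < a by exact: leq_ltn_trans N_lt_a.
have copFa := coprime_dvd_add aF copFN.
have pNa : ~~ (p %| a) by apply: contra copNp => pa; rewrite -(dvdn_addr N pa).
have odd_a : odd a.
  by rewrite -coprime2n (coprime_dvdl _ copFa) // (dvdn_trans _ F4).
have aN : kronecker p a = (-1)%R.
  rewrite kronecker_reciprocity // (legendreN pp odd_p ap) Np.
  by rewrite p_half exprM sqrrN !expr1n.
pose f := (F * p) ^ a.
have Fp_dvd : F * p %| f by exact: dvdn_exp.
have F_dvd : F %| f by apply: dvdn_trans Fp_dvd; exact: dvdn_mulr.
have p_dvd : p %| f by apply: dvdn_trans Fp_dvd; exact: dvdn_mull.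
have a_lt_f : a < f.
  by rewrite ltn_expl // (leq_trans (prime_gt1 pp)) // leq_pmull.
have [|||s [ps sa sP]] := star a f p _ _ _ pp odd_p p_dvd aN.
- by rewrite a_gt0 ltnW.
- apply/eqP; rewrite -/(coprime _ _) coprimeXr // coprimeMr.
  by rewrite coprime_sym copFa coprime_sym prime_coprime.
- exact: dvdn_trans F_dvd.
exists s; split=> //; last by rewrite (dvdn_eqmod _ (eqmod_dvd p_dvd sa)).
  by rewrite (leq_trans N_lt_a) // -(modn_small a_lt_f) -sa leq_mod.
by rewrite (dvdn_eqmod _ (eqmod_dvd F_dvd sa)).
Qed.

(** Any nonzero class modulo s, here that of -N, is a power of a primitive
    root, and the exponent matters only modulo s - 1. *)
Lemma exists_exponent p s N :
  prime s -> ~~ (s %| N) -> primitive_root_mod p s ->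
  exists i, forall k, s %| p ^ (i + s.-1 * k) + N.
Proof.
move=> ps sN pP.
have N0 : (- (N%:R) != 0 :> 'F_s)%R by rewrite oppr_eq0 natF_eq0.
have [i iE] := prim_rootP pP (expF_pred ps N0).
exists i => k; rewrite -natF_eq0 // natrD natrX exprD exprM.
by rewrite (prim_expr_order pP) expr1n mulr1 -iE addNr.
Qed.

(** * Sums of four prime powers *)

Lemma odd_prime_neq2 p : prime p -> p != 2 -> odd p.
Proof. by move=> pp p2; case: (even_prime pp) p2 => [->|]. Qed.

Lemma size_primes_gt1 n p q : 0 < n -> prime p -> prime q -> p != q ->
  p %| n -> q %| n -> 1 < size (primes n).
Proof.
move=> n_gt0 pp pq neq_pq pn qn.
have : uniq [:: p; q] by rewrite /= inE neq_pq.
move/uniq_leq_size; apply=> x; rewrite !inE mem_primes n_gt0.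
by move=> /orP[]/eqP->; apply/andP.
Qed.

(** Fewer terms are impossible: one term would make n a prime power, with two
    each prime would divide the other, and with three parity makes one
    prime equal to 2, which [sum3_not_dvd8] excludes. *)
Lemma prime_power_sum_ge4 n t : 8 %| n -> 1 < size (primes n) ->
  prime_power_sum n t -> 4 <= t.
Proof.
move=> n8 n_gt1 [p [a [p_inj p_n a_gt0 nE]]].
have pp i : prime (p i) by case/andP: (p_n i).
have pn i : p i %| n by case/andP: (p_n i).
case: t => [|[|[|[|//]]]] in p a p_inj p_n a_gt0 nE pp pn *.
- by rewrite nE big_ord0 in n_gt1.
- rewrite nE big_ord1 in n_gt1.
  by rewrite (primesX _ (a_gt0 _)) primes_prime in n_gt1.
- pose i0 : 'I_2 := ord0; pose i1 : 'I_2 := lift ord0 ord0.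
  have nE2 : n = p i0 ^ a i0 + p i1 ^ a i1 by rewrite nE big_ord_recl big_ord1.
  have : p i0 %| p i1 ^ a i1.
    by rewrite -(dvdn_addr (m := p i0 ^ a i0)) -?nE2 ?dvdn_exp.
  by rewrite Euclid_dvdX // dvdn_prime2 // a_gt0 andbT => /eqP /p_inj.
- pose i0 : 'I_3 := ord0; pose i1 : 'I_3 := lift ord0 ord0.
  pose i2 : 'I_3 := lift ord0 (lift ord0 ord0).
  have nE3 : n = p i0 ^ a i0 + p i1 ^ a i1 + p i2 ^ a i2.
    by rewrite nE big_ord_recl big_ord_recl big_ord1 addnA.
  have neq i j : i != j -> p i != p j by apply: contraNneq => /p_inj ->.
  have only i j : p i = 2 -> i != j -> odd (p j).
    by move=> pi2 /neq; rewrite pi2 eq_sym => /(odd_prime_neq2 (pp j)).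
  have even_n : ~~ odd n by rewrite -dvdn2 (dvdn_trans _ n8).
  have contra2 i j k : n = p i ^ a i + p j ^ a j + p k ^ a k ->
      i != j -> i != k -> j != k -> p i = 2 -> False.
    move=> nE' ij ik jk pi2; rewrite pi2 in nE'.
    have := @sum3_not_dvd8 (p j) (p k) (a i) (a j) (a k) (pp j)
      (only _ _ pi2 ij)
      (pp k) (only _ _ pi2 ik) (neq _ _ jk) (a_gt0 i) (a_gt0 j) (a_gt0 k).
    by rewrite -nE' => /(_ (pn j) (pn k)); rewrite n8.
  have [/eqP pi0|p0] := boolP (p i0 == 2).
    by case: (contra2 i0 i1 i2).
  have [/eqP pi1|p1] := boolP (p i1 == 2).
    by case: (contra2 i1 i0 i2); rewrite // nE3 [p i0 ^ _ + _]addnC.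
  have [/eqP pi2|p2] := boolP (p i2 == 2).
    by case: (contra2 i2 i0 i1); rewrite // nE3 addnC addnA.
  by move: even_n; rewrite nE3 !oddD !oddX !(odd_prime_neq2 (pp _)) // !orbT.
Qed.

Lemma half_mod8_6 n : n %% 8 = 6 -> n./2 %% 4 = 3 /\ n = 2 * n./2.
Proof. lia. Qed.

Lemma mod4_3_odd n : n %% 4 = 3 -> odd n.
Proof. lia. Qed.

Lemma dvd4S_odd n : 4 %| n.+1 -> odd n.
Proof. lia. Qed.

Lemma addn_mod8_6 x y : 8 %| x.+1 -> 8 %| y.+1 -> (x + y) %% 8 = 6.
Proof. lia. Qed.

Lemma odd_eqmod1_gt q r : odd q -> odd r -> 1 < r -> r = 1 %[mod q] -> q.+1 < r.
Proof.
move=> odd_q odd_r r_gt1 /eqP; rewrite eqn_mod_dvd ?(ltnW r_gt1) // => qr.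
by have := dvdn_leq _ qr; lia.
Qed.

(** The construction explained at the top.  The symbol (N/p) equals that of
    N/2 because p = 1 modulo 8 makes 2 a square modulo p. *)
Lemma exists_large_sum4 M B : primitive_root_hypothesis -> 8 %| M -> 0 < M ->
  exists n, [/\ B < n, M %| n, prime_power_sum n 4 & 1 < size (primes n)].
Proof.
move=> star M8 M_gt0.
have M4 : 4 %| M by exact: dvdn_trans M8.
have [q [r [pq pr Mq Mr rq]]] := exists_prime_pair star M4 M_gt0.
have odd_q := dvd4S_odd (dvdn_trans M4 Mq).
have odd_r := dvd4S_odd (dvdn_trans M4 Mr).
have q_lt_r := odd_eqmod1_gt odd_q odd_r (prime_gt1 pr) rq.
have neq_qr : q != r by rewrite neq_ltn (ltnW q_lt_r).
pose N := q + r; pose F := M * q * r.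
have N6 : N %% 8 = 6.
  exact: addn_mod8_6 (dvdn_trans M8 Mq) (dvdn_trans M8 Mr).
have F_gt0 : 0 < F by rewrite !muln_gt0 M_gt0 !prime_gt0.
have M_F : M %| F by rewrite /F -mulnA dvdn_mulr.
have q_F : q %| F by rewrite /F mulnAC dvdn_mull.
have r_F : r %| F by rewrite dvdn_mull.
have F4 : 4 %| F := dvdn_trans M4 M_F.
have MN : M %| N.+1 + 1.
  by have -> : N.+1 + 1 = q.+1 + r.+1 by [rewrite /N; lia]; exact: dvdn_add.
have copFN1 : coprime F N.+1.
  rewrite !coprimeMl (coprime_dvd_add MN (coprimen1 _)) /= !prime_coprime //.
  apply/andP; split.
    rewrite /N -addnS dvdn_addr // -addn1 (dvdn_eqmod 1 rq).
    by rewrite gtnNdvd // odd_gt2 ?prime_gt1.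
  rewrite /N -addSn dvdn_addl //.
  by rewrite gtnNdvd.
have [half3 NE] := half_mod8_6 N6.
have odd_half := mod4_3_odd half3.
have halfN : N./2 %| N by rewrite {2}NE dvdn_mull.
have copFN : coprime F N./2.
  rewrite !coprimeMl -andbA !(prime_coprime _ pq, prime_coprime _ pr).
  apply/and3P; split.
  - set g := gcdn M N./2.
    have odd_g : odd g := dvdn_odd (dvdn_gcdr _ _) odd_half.
    rewrite /coprime -/g -dvdn1 -(@Gauss_dvdl g 1 2) ?coprimen2 // mul1n.
    rewrite -(dvdn_addr 2 (dvdn_trans (dvdn_gcdr _ _) halfN : g %| N)).
    by rewrite addn2 -[N.+2]addn1 (dvdn_trans (dvdn_gcdl _ _)).
  - apply/negP => /dvdn_trans/(_ halfN); rewrite /N dvdn_addr // dvdn_prime2 //.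
    exact/negP.
  - apply/negP => /dvdn_trans/(_ halfN).
    rewrite /N dvdn_addl // dvdn_prime2 // eq_sym.
    exact/negP.
have [p [pp pF pN]] :=
  exists_prime_nonresidue star odd_half (mod4_3_nonsquare half3) F4 copFN.
have p8 : p %% 8 = 1 by rewrite (eqmod_dvd (dvdn_trans M8 M_F) pF).
have odd_p : odd p by rewrite (divn_eq p 8) p8 oddD oddM andbF.
have {}pN : legendre N p = (-1)%R.
  by rewrite {1}NE legendreM // legendre2 // p8 expr0 mul1r.
have [s [ps N_lt_s Fs pNs sP]] :=
  exists_prime_with_root star F_gt0 F4 copFN1 pp pF pN.
have sN : ~~ (s %| N).
  by rewrite gtnNdvd // addn_gt0 prime_gt0.
have [i iP] := exists_exponent ps sN sP.
have pNN : ~~ (p %| N) by rewrite -legendre_neq0 // pN.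
have neq_ps : p != s.
  apply: contraNneq pNN => ps_eq.
  by rewrite -(dvdn_addr N (dvdnn p)) {2}ps_eq.
have pF1 d : d %| F -> p = 1 %[mod d] by move=> dF; apply: eqmod_dvd pF.
have neq_F l : prime l -> l %| F -> p != l.
  move=> pl lF; apply/negP => /eqP pl_eq; have := pF1 _ lF.
  by rewrite pl_eq modnn modn_small ?prime_gt1.
have [neq_pq neq_pr] := (neq_F _ pq q_F, neq_F _ pr r_F).
pose e := i + s.-1 * B.+1.
have B_lt_e : B < e.
  by rewrite ltn_addl // leq_pmull // -subn1 subn_gt0 prime_gt1.
(* modulo F, p^e = 1 and s = -(1 + N) *)
have Fn : F %| p ^ e + N + s.
  have pe1 : p ^ e = 1 %[mod F] by rewrite -modnXm pF modnXm exp1n.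
  by rewrite -addnA (dvdn_eqmod _ pe1) addnA add1n addnC.
pose n := p ^ e + N + s.
have e_gt0 : 0 < e := leq_ltn_trans (leq0n B) B_lt_e.
have pn : p %| n by rewrite /n -addnA dvdn_add ?dvdn_exp // addnC.
have sn : s %| n := dvdn_add (iP B.+1) (dvdnn s).
have [qn rn] := (dvdn_trans q_F Fn, dvdn_trans r_F Fn).
have n_gt : B < n.
  by rewrite /n (ltn_trans B_lt_e) // -addnA ltn_addr // ltn_expl // prime_gt1.
exists n; split=> //; first exact: dvdn_trans Fn.
  exists (tnth [tuple p; q; r; s]), (tnth [tuple e; 1; 1; 1]); split.
  - apply/tuple_uniqP; rewrite /= !inE !negb_or neq_pq neq_pr neq_ps neq_qr.
    by rewrite !ltn_eqF // (leq_ltn_trans _ N_lt_s) ?leq_addl ?leq_addr.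
  - move=> j; apply/andP; have := mem_tnth j [tuple p; q; r; s].
    by rewrite !inE => /or4P[]/eqP->.
  - move=> j; have := mem_tnth j [tuple e; 1; 1; 1].
    by rewrite !inE => /or4P[]/eqP->.
  - rewrite !big_ord_recl big_ord0 /= !(tnth_nth 0) /= !expn1.
    by rewrite /n /N addn0 !addnA.
exact: size_primes_gt1 (leq_ltn_trans _ n_gt) pp pq neq_pq pn qn.
Qed.

Theorem theorem1
  (star : forall a f g : nat,
     1 <= a <= f -> gcdn a f = 1 -> 4 %| f ->
     prime g -> odd g -> g %| f ->
     kronecker g%:Z a%:Z = (-1)%R ->
     exists p : nat,
       [/\ prime p, p = a %[mod f] & primitive_root_mod g p])
  (m : nat) (m_gt0 : 0 < m) :
  infinite_set
    [set n : nat | [/\ weakly_prime_additive n, m %| n & kappa n = 4]]%classic.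
Proof.
move=> /finite_seqP[ns nsE].
have [||n [n_gt Mn n4 n_gt1]] := @exists_large_sum4 (8 * m) (sumn ns) star.
- exact: dvdn_mulr.
- by rewrite muln_gt0.
have n_wpa : weakly_prime_additive n by split=> //; exists 4.
have : [set` ns]%classic n.
  rewrite -nsE; split=> //; first exact: dvdn_trans (dvdn_mull _ (dvdnn m)) Mn.
  apply/(kappaP _ n_wpa); split=> // t; apply: prime_power_sum_ge4 => //.
  exact: dvdn_trans (dvdn_mulr _ (dvdnn 8)) Mn.
move=> /= n_in; move: n_gt; rewrite ltnNge => /negP; apply.
elim: ns {nsE} n_in => //= x ns IHns; rewrite inE => /orP[/eqP->|/IHns].
  exact: leq_addr.
by move=> n_le; rewrite (leq_trans n_le) // leq_addl.
Qed.
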